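(* Consider a bicycling geodesic in $\mathbb{R}^3$ with non-linear front track $\mathbf{x}(t)$, parametrized by arc length, with frame direction $\mathbf{v}(t)$ and parameter $a\ge0$. Then at a point of the front track with maximum curvature value, where $\kappa=1+a$, the bicycle frame $\mathbf{v}$ is perpendicular to the front track and anti-aligned with the acceleration vector: $$\mathbf{v}=-\frac{\mathbf{x}''}{1+a}.$$
   Context: A bicycle path in $\mathbb{R}^3$ is a pair of curves $(\mathbf{x}(t),\mathbf{y}(t))$ (front and back tracks) such that $\mathbf{v}:=\mathbf{x}-\mathbf{y}$ (the frame direction) satisfies $|\mathbf{v}|=1$ and $\mathbf{y}'\parallel\mathbf{v}$ for all $t$. A bicycling geodesic is a bicycle path whose length (length of the front track) between any two of its placements is critical among bicycle paths connecting these placements. Non-linear means not a straight line. Unit speed bicycling geodesics are exactly the bicycle paths for which there exist a constant vector $\mathbf{p}\in\mathbb{R}^3$ and $\mathbf{r}(t)\in\mathbb{R}^3$ with $$\mathbf{x}'=\mathbf{p}+\mathbf{r},\quad \mathbf{v}'=\mathbf{p}+\mathbf{r}-(\mathbf{v}\cdot\mathbf{p})\mathbf{v},\quad \mathbf{p}'=0,\quad \mathbf{r}'=(\mathbf{v}\cdot\mathbf{p})\mathbf{r}-[\mathbf{r}\cdot(\mathbf{r}+\mathbf{p})]\mathbf{v},\quad |\mathbf{v}|=1,\ \mathbf{r}\cdot\mathbf{v}=0,\ |\mathbf{x}'|=1.$$ Here $b:=\mathbf{p}\cdot(\mathbf{v}\times\mathbf{x}')$ is constant, $|b|\le|\mathbf{p}|$,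 and $a\ge0$ is defined by $a^2=|\mathbf{p}|^2-b^2$. The curvature $\kappa$ is that of an analytic Frenet-Serret frame ($\mathbf{x}''=\kappa\mathbf{N}$, $|\mathbf{N}|=1$), so it may change sign at inflection points; it is chosen positive if it has no zeros. The maximum value of $\kappa$ along a non-linear geodesic front track is $1+a$. *)

(* Defs.v *)
From Stdlib Require Import Reals.
From Coquelicot Require Import Coquelicot.
Open Scope R_scope.

(* Vector addition, subtraction and scaling on R^3 are Coquelicot's [plus],
   [minus], [opp], [scal], which act componentwise on products. *)
Definition vec3 : Type := (R * R * R)%type.

Definition c1 (u : vec3) : R := fst (fst u).
Definition c2 (u : vec3) : R := snd (fst u).
Definition c3 (u : vec3) : R := snd u.

Definition dot (u w : vec3) : R := c1 u * c1 w + c2 u * c2 w + c3 u * c3 w.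

Definition cross (u w : vec3) : vec3 :=
  (c2 u * c3 w - c3 u * c2 w,
   c3 u * c1 w - c1 u * c3 w,
   c1 u * c2 w - c2 u * c1 w).

Definition vnorm (u : vec3) : R := sqrt (dot u u).

(* Total, like [Derive]; only meaningful for differentiable curves. *)
Definition vderive (f : R -> vec3) (t : R) : vec3 :=
  (Derive (fun s => c1 (f s)) t,
   Derive (fun s => c2 (f s)) t,
   Derive (fun s => c3 (f s)) t).

Definition smooth (f : R -> vec3) : Prop :=
  forall (n : nat) (t : R),
    ex_derive_n (fun s => c1 (f s)) n t /\
    ex_derive_n (fun s => c2 (f s)) n t /\
    ex_derive_n (fun s => c3 (f s)) n t.

(* Joint smoothness in (e, s), for e near 0. *)
Definition smooth_family (delta : R) (F : R -> R -> vec3) : Prop :=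
  forall (n : nat) (e s : R), Rabs e < delta ->
    ex_diff_n (fun e' s' => c1 (F e' s')) n e s /\
    ex_diff_n (fun e' s' => c2 (F e' s')) n e s /\
    ex_diff_n (fun e' s' => c3 (F e' s')) n e s.

Definition analytic (f : R -> R) : Prop :=
  forall t0 : R, exists (c : nat -> R) (delta : R), 0 < delta /\
    forall t : R, Rabs (t - t0) < delta -> is_pseries c (t - t0) (f t).

Definition vanalytic (f : R -> vec3) : Prop :=
  analytic (fun s => c1 (f s)) /\
  analytic (fun s => c2 (f s)) /\
  analytic (fun s => c3 (f s)).

(* x is the front track and y the back track. *)
Definition frame_direction (x y : R -> vec3) (t : R) : vec3 :=
  minus (x t) (y t).

Definition bicycle_path (x y : R -> vec3) : Prop :=
  smooth x /\ smooth y /\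
  forall t : R,
    vnorm (frame_direction x y t) = 1 /\
    exists c : R, vderive y t = scal c (frame_direction x y t).

Definition front_length (x : R -> vec3) (t1 t2 : R) : R :=
  RInt (fun t => vnorm (vderive x t)) t1 t2.

(* One-parameter deformations, through bicycle paths, of the piece of (x, y)
   between the placements at times t1 and t2, with these placements fixed.
   Reparametrizing the deformed paths lets all of them use [t1, t2]. *)
Definition bicycle_variation (x y : R -> vec3) (t1 t2 delta : R)
    (X Y : R -> R -> vec3) : Prop :=
  smooth_family delta X /\ smooth_family delta Y /\
  (forall e : R, Rabs e < delta -> bicycle_path (X e) (Y e)) /\
  (forall t : R, t1 <= t <= t2 -> X 0 t = x t /\ Y 0 t = y t) /\
  (forall e : R, Rabs e < delta ->
    X e t1 = x t1 /\ Y e t1 = y t1 /\ X e t2 = x t2 /\ Y e t2 = y t2).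

Definition bicycling_geodesic (x y : R -> vec3) : Prop :=
  bicycle_path x y /\
  forall (t1 t2 delta : R) (X Y : R -> R -> vec3),
    t1 < t2 -> 0 < delta ->
    bicycle_variation x y t1 t2 delta X Y ->
    is_derive (fun e => front_length (X e) t1 t2) 0 0.

Definition unit_speed (x : R -> vec3) : Prop :=
  forall t : R, vnorm (vderive x t) = 1.

Definition linear_track (x : R -> vec3) : Prop :=
  exists q d : vec3, forall t : R, exists s : R, x t = plus q (scal s d).

Definition geodesic_equations (x v : R -> vec3) (p : vec3) (r : R -> vec3)
    : Prop :=
  smooth r /\
  forall t : R,
    vderive x t = plus p (r t) /\
    vderive v t = minus (plus p (r t)) (scal (dot (v t) p) (v t)) /\
    vderive r t = minus (scal (dot (v t) p) (r t))
                  (scal (dot (r t) (plus (r t) p)) (v t)) /\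
    vnorm (v t) = 1 /\
    dot (r t) (v t) = 0 /\
    vnorm (vderive x t) = 1.

(* a is the nonnegative number with a^2 = |p|^2 - b^2, where
   b = p . (v x x') is the constant of motion. *)
Definition geodesic_parameter (x v : R -> vec3) (a : R) : Prop :=
  exists (p : vec3) (r : R -> vec3) (b : R),
    geodesic_equations x v p r /\
    (forall t : R, dot p (cross (v t) (vderive x t)) = b) /\
    0 <= a /\ a ^ 2 = vnorm p ^ 2 - b ^ 2.

(* An analytic Frenet-Serret frame (x', N, x' x N) along a unit speed curve,
   with signed curvature; reversing N reverses kappa, and this freedom is
   used to make kappa positive whenever it has no zeros. *)
Definition frenet_serret (x N : R -> vec3) (kappa tau : R -> R) : Prop :=
  vanalytic N /\ analytic kappa /\ analytic tau /\
  (forall t : R,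
    vnorm (N t) = 1 /\ dot (vderive x t) (N t) = 0 /\
    vderive (vderive x) t = scal (kappa t) (N t) /\
    vderive N t = plus (scal (- kappa t) (vderive x t))
                 (scal (tau t) (cross (vderive x t) (N t))) /\
    vderive (fun s => cross (vderive x s) (N s)) t = scal (- tau t) (N t)) /\
  ((forall t : R, kappa t <> 0) -> forall t : R, 0 < kappa t).

(* Main.v *)
From Stdlib Require Import Reals Psatz.
From Coquelicot Require Import Coquelicot.
Require Import Defs.
Open Scope R_scope.

(** Write T = x' = p + r, c = v . p (which is v . T, because r is orthogonal to
    v) and w = r . T = 1 - p . T.  The acceleration is x'' = r' = c r - w v.  The
    Gram determinant of p, v, T turns the definition of a into the energy
    identity
<<
      c^2 |r|^2 + (1 - w)^2 = a^2,
>>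
    and then kappa^2 = |r'|^2 = c^2 |r|^2 + w^2 = a^2 - 1 + 2 w
    ([geodesic_energy], [curvature_sqr]).  So kappa^2 lies between (1 - a)^2
    and (1 + a)^2.  At an upper endpoint, w = 1 + a, the energy identity leaves
    c r = 0 with r <> 0, hence c = 0 and x'' = - (1 + a) v
    ([frame_at_maximal_curvature]): this is the claim, once kappa = 1 + a is
    known at t0.

    As kappa^2 differs from |r|^2 by a constant and |r|^2 has derivative
    2 c |r|^2, the condition kappa'(t0) = 0 forces c |r|^2 = 0, so that
    w = 1 + a or w = 1 - a at t0, and the lower endpoint has to be excluded.

    If kappa has no zeros, it is positive.  A maximum at the lower endpoint
    makes kappa constant, so that c |r|^2 vanishes identically; then c
    vanishes identically, and c' = 1 - w - c^2 gives w = 1, so a = 0 and both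
    endpoints coincide.

    If kappa has a zero, then a = 1 and the lower endpoint is kappa(t0) = 0.
    Differentiating c |r|^2 = r . r' = kappa (r . N) at t0 gives r(t0) = 0
    ([flat_inflection]).  The linear equation for |r|^2 then makes r vanish
    identically, so that x' = p and the front track is a line
    ([linear_track_of_zero]). *)

(** * Vector algebra in R^3 *)

Lemma vec3_ext (u w : vec3) :
  c1 u = c1 w -> c2 u = c2 w -> c3 u = c3 w -> u = w.
Proof.
  destruct u as [[u1 u2] u3], w as [[w1 w2] w3].
  unfold c1, c2, c3; simpl; intros -> -> ->; reflexivity.
Qed.

Lemma dot_comm (u w : vec3) : dot u w = dot w u.
Proof. unfold dot; ring. Qed.

Lemma dot_plus_l (u1 u2 w : vec3) : dot (plus u1 u2) w = dot u1 w + dot u2 w.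
Proof. unfold dot, c1, c2, c3; simpl; unfold plus; simpl; ring. Qed.

Lemma dot_plus_r (u w1 w2 : vec3) : dot u (plus w1 w2) = dot u w1 + dot u w2.
Proof. now rewrite dot_comm, dot_plus_l, !(dot_comm u). Qed.

Lemma dot_scal_l (k : R) (u w : vec3) : dot (scal k u) w = k * dot u w.
Proof.
  unfold dot, c1, c2, c3; simpl; unfold scal; simpl; unfold mult; simpl; ring.
Qed.

Lemma dot_scal_r (k : R) (u w : vec3) : dot u (scal k w) = k * dot u w.
Proof. now rewrite dot_comm, dot_scal_l, (dot_comm u). Qed.

Lemma dot_minus_l (u1 u2 w : vec3) : dot (minus u1 u2) w = dot u1 w - dot u2 w.
Proof.
  unfold dot, c1, c2, c3, minus; simpl; unfold plus, opp; simpl; ring.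
Qed.

Lemma dot_minus_r (u w1 w2 : vec3) : dot u (minus w1 w2) = dot u w1 - dot u w2.
Proof. now rewrite dot_comm, dot_minus_l, !(dot_comm u). Qed.

Lemma dot_self_ge0 (u : vec3) : 0 <= dot u u.
Proof. unfold dot; nra. Qed.

Lemma dot_self_eq0 (u : vec3) : dot u u = 0 -> u = zero.
Proof.
  unfold dot; intros H; apply vec3_ext.
  - change (c1 u = 0); nra.
  - change (c2 u = 0); nra.
  - change (c3 u = 0); nra.
Qed.

Lemma dot_zero_l (w : vec3) : dot zero w = 0.
Proof. unfold dot, c1, c2, c3; simpl; unfold zero; simpl; ring. Qed.

Lemma vnorm_sqr (u : vec3) : vnorm u ^ 2 = dot u u.
Proof. apply pow2_sqrt, dot_self_ge0. Qed.

Lemma vnorm_eq1 (u : vec3) : vnorm u = 1 -> dot u u = 1.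
Proof. intros H; rewrite <- vnorm_sqr, H; ring. Qed.

(** The square of a triple product is the Gram determinant. *)
Lemma triple_product_sqr (p v q : vec3) :
  dot p (cross v q) ^ 2 =
  dot p p * (dot v v * dot q q - dot v q ^ 2)
  - dot p v * (dot p v * dot q q - dot v q * dot p q)
  + dot p q * (dot p v * dot v q - dot v v * dot p q).
Proof. unfold dot, cross, c1, c2, c3; simpl; ring. Qed.

(** * Differentiation of vector-valued functions *)

Definition vdifferentiable (f : R -> vec3) (t : R) : Prop :=
  ex_derive (fun s => c1 (f s)) t /\
  ex_derive (fun s => c2 (f s)) t /\
  ex_derive (fun s => c3 (f s)) t.

Lemma smooth_vdifferentiable (f : R -> vec3) (t : R) :
  smooth f -> vdifferentiable f t.
Proof. intros H; exact (H 1%nat t). Qed.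

Lemma vdifferentiable_const (u : vec3) (t : R) : vdifferentiable (fun _ => u) t.
Proof. repeat split; apply ex_derive_const. Qed.

Lemma vdifferentiable_minus (f g : R -> vec3) (t : R) :
  vdifferentiable f t -> vdifferentiable g t ->
  vdifferentiable (fun s => minus (f s) (g s)) t.
Proof.
  intros (F1 & F2 & F3) (G1 & G2 & G3).
  exact (conj (ex_derive_minus _ _ _ F1 G1)
        (conj (ex_derive_minus _ _ _ F2 G2) (ex_derive_minus _ _ _ F3 G3))).
Qed.

Lemma is_derive_dot (f g : R -> vec3) (t : R) :
  vdifferentiable f t -> vdifferentiable g t ->
  is_derive (fun s => dot (f s) (g s)) t
    (dot (vderive f t) (g t) + dot (f t) (vderive g t)).
Proof.
  intros (F1 & F2 & F3) (G1 & G2 & G3).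
  pose proof (fun h k (H : ex_derive h t) (K : ex_derive k t) =>
    is_derive_mult _ _ _ _ _ (Derive_correct h t H) (Derive_correct k t K)
      Rmult_comm) as D.
  evar_last.
  - exact (is_derive_plus _ _ _ _ _
            (is_derive_plus _ _ _ _ _ (D _ _ F1 G1) (D _ _ F2 G2))
            (D _ _ F3 G3)).
  - unfold plus, mult; simpl; unfold dot, vderive, c1, c2, c3; simpl; ring.
Qed.

Lemma is_derive_dot_const (f : R -> vec3) (u : vec3) (t : R) :
  vdifferentiable f t ->
  is_derive (fun s => dot (f s) u) t (dot (vderive f t) u).
Proof.
  intros F; evar_last.
  - apply (is_derive_dot f (fun _ => u) t F (vdifferentiable_const u t)).
  - unfold dot, vderive, c1, c2, c3; simpl; rewrite !Derive_const; ring.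
Qed.

Lemma vderive_ext (f g : R -> vec3) (t : R) :
  (forall s, f s = g s) -> vderive f t = vderive g t.
Proof.
  intros H; apply vec3_ext; apply Derive_ext; intros s; now rewrite H.
Qed.

Lemma vderive_plus_const (u : vec3) (f : R -> vec3) (t : R) :
  vdifferentiable f t -> vderive (fun s => plus u (f s)) t = vderive f t.
Proof.
  intros (F1 & F2 & F3).
  assert (D : forall (k : R) (h : R -> R), ex_derive h t ->
             Derive (fun s => k + h s) t = Derive h t).
  { intros k h Hh; rewrite Derive_plus, Derive_const; auto.
    - ring.
    - apply ex_derive_const. }
  apply vec3_ext; [exact (D (c1 u) _ F1) | exact (D (c2 u) _ F2)
                  | exact (D (c3 u) _ F3)].
Qed.

Lemma is_derive_zero_const (f : R -> R) :
  (forall t, is_derive f t 0) -> forall s t, f s = f t.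
Proof.
  intros H s t.
  destruct (MVT_gen f s t (fun _ => 0)) as (z & _ & E).
  - intros; apply H.
  - intros z _; apply continuity_pt_filterlim.
    apply (ex_derive_continuous f z); eexists; apply H.
  - lra.
Qed.

(** Locally f is a power series whose radius of convergence is positive. *)
Lemma analytic_ex_derive (f : R -> R) (t : R) : analytic f -> ex_derive f t.
Proof.
  intros H; destruct (H t) as (c & d & Hd & Hs).
  apply ex_derive_ext_loc with (fun s => PSeries c (s - t)).
  { exists (mkposreal d Hd); intros s Hb.
    apply is_pseries_unique, Hs, Hb. }
  assert (Hr : Rbar_lt (Rabs (t - t)) (CV_radius c)).
  { rewrite Rminus_diag, Rabs_R0.
    apply Rbar_lt_le_trans with (Rabs (d / 2)).
    { simpl; rewrite Rabs_pos_eq; lra. }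
    (* Beyond the radius of convergence the terms would not tend to 0. *)
    apply Rbar_not_lt_le; intros Hlt.
    apply (CV_disk_outside _ _ Hlt), ex_series_lim_0, ex_pseries_R.
    exists (f (t + d / 2)).
    specialize (Hs (t + d / 2)).
    replace (t + d / 2 - t) with (d / 2) in Hs by ring.
    apply Hs; rewrite Rabs_pos_eq; lra. }
  apply (ex_derive_comp (PSeries c) (fun s => s - t)).
  - now apply ex_derive_PSeries.
  - auto_derive; trivial.
Qed.

Lemma vanalytic_vdifferentiable (f : R -> vec3) (t : R) :
  vanalytic f -> vdifferentiable f t.
Proof.
  intros (H1 & H2 & H3).
  repeat split; now apply analytic_ex_derive.
Qed.

Lemma is_derive_at_maximum (f : R -> R) (t0 : R) :
  ex_derive f t0 -> (forall t, f t <= f t0) -> is_derive f t0 0.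
Proof.
  intros Hd Hm.
  pose proof (ex_derive_Reals_0 _ _ Hd) as pr.
  assert (E : derive_pt f t0 pr = 0)
    by (apply (deriv_maximum f (t0 - 1) (t0 + 1)); [lra | lra | auto]).
  rewrite <- E; apply is_derive_Reals.
  exact (proj2_sig pr).
Qed.

(** * Pointwise identities *)

(** Expand b^2 as the Gram determinant of p, v and p + r, and eliminate |r|^2
    by means of |p + r| = 1. *)
Lemma energy_identity (p r v : vec3) (a b : R) :
  dot v v = 1 -> dot r v = 0 -> dot (plus p r) (plus p r) = 1 ->
  dot p (cross v (plus p r)) = b -> a ^ 2 = dot p p - b ^ 2 ->
  dot v p ^ 2 * dot r r + (1 - dot r (plus r p)) ^ 2 = a ^ 2.
Proof.
  intros Hv Hrv HT <- ->.
  rewrite triple_product_sqr.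
  rewrite ?dot_plus_l, ?dot_plus_r in *.
  rewrite Hv, (dot_comm p v), (dot_comm v r), Hrv, (dot_comm r p) in *.
  assert (E : dot r r = 1 - dot p p - 2 * dot p r) by lra.
  rewrite E; ring.
Qed.

Lemma acceleration_sqr (r v : vec3) (c w : R) :
  dot v v = 1 -> dot r v = 0 ->
  dot (minus (scal c r) (scal w v)) (minus (scal c r) (scal w v)) =
  c ^ 2 * dot r r + w ^ 2.
Proof.
  intros Hv Hrv.
  rewrite ?dot_minus_l, ?dot_minus_r, ?dot_scal_l, ?dot_scal_r.
  rewrite (dot_comm v r), Hv, Hrv; ring.
Qed.

(** * Dynamics of geodesics *)

Lemma geodesic_r_sqr (x v r : R -> vec3) (p : vec3) (t : R) :
  geodesic_equations x v p r ->
  dot (r t) (r t) = 2 * dot (r t) (plus (r t) p) - 1 + dot p p.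
Proof.
  intros (_ & H); destruct (H t) as (Hx & _ & _ & _ & _ & HT).
  rewrite Hx in HT; apply vnorm_eq1 in HT.
  rewrite ?dot_plus_l, ?dot_plus_r, (dot_comm (r t) p) in *; lra.
Qed.

Lemma geodesic_energy (x v r : R -> vec3) (p : vec3) (a b : R) (t : R) :
  geodesic_equations x v p r ->
  (forall s, dot p (cross (v s) (vderive x s)) = b) ->
  a ^ 2 = vnorm p ^ 2 - b ^ 2 ->
  dot (v t) p ^ 2 * dot (r t) (r t) + (1 - dot (r t) (plus (r t) p)) ^ 2
  = a ^ 2.
Proof.
  intros (_ & H) Hb Ha; destruct (H t) as (Hx & _ & _ & Hv & Hrv & HT).
  specialize (Hb t); rewrite Hx in *.
  apply energy_identity with b; auto using vnorm_eq1.
  now rewrite <- vnorm_sqr.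
Qed.

Lemma geodesic_acceleration (x v r : R -> vec3) (p : vec3) (t : R) :
  geodesic_equations x v p r ->
  vderive (vderive x) t =
  minus (scal (dot (v t) p) (r t)) (scal (dot (r t) (plus (r t) p)) (v t)).
Proof.
  intros (Hs & H).
  rewrite (vderive_ext _ (fun s => plus p (r s))) by (intros s; apply H).
  rewrite vderive_plus_const by now apply smooth_vdifferentiable.
  apply H.
Qed.

Lemma curvature_sqr (x v r N : R -> vec3) (kappa : R -> R) (p : vec3)
    (a b t : R) :
  geodesic_equations x v p r ->
  (forall s, dot p (cross (v s) (vderive x s)) = b) ->
  a ^ 2 = vnorm p ^ 2 - b ^ 2 ->
  vnorm (N t) = 1 ->
  vderive (vderive x) t = scal (kappa t) (N t) ->
  kappa t ^ 2 = a ^ 2 - 1 + 2 * dot (r t) (plus (r t) p).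
Proof.
  intros G Hb Ha HN Hk.
  rewrite <- (geodesic_energy x v r p a b t G Hb Ha).
  assert (E : kappa t ^ 2 = dot (vderive (vderive x) t) (vderive (vderive x) t)).
  { rewrite Hk, dot_scal_l, dot_scal_r, (vnorm_eq1 _ HN); ring. }
  rewrite E, (geodesic_acceleration x v r p t G).
  destruct G as (_ & H); destruct (H t) as (_ & _ & _ & Hv & Hrv & _).
  rewrite acceleration_sqr by auto using vnorm_eq1.
  ring.
Qed.

(** The part of r' along v is orthogonal to r, so only the linear term of r'
    contributes. *)
Lemma is_derive_r_sqr (x v r : R -> vec3) (p : vec3) (t : R) :
  geodesic_equations x v p r ->
  is_derive (fun s => dot (r s) (r s)) t
    (2 * (dot (v t) p * dot (r t) (r t))).
Proof.
  intros (Hs & H); destruct (H t) as (_ & _ & Hr & _ & Hrv & _).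
  evar_last.
  - apply is_derive_dot; now apply smooth_vdifferentiable.
  - rewrite Hr, dot_minus_l, dot_minus_r, !dot_scal_l, !dot_scal_r.
    rewrite (dot_comm (v t) (r t)), Hrv; ring.
Qed.

Lemma is_derive_v_dot_p (x v r : R -> vec3) (p : vec3) (t : R) :
  vdifferentiable v t ->
  geodesic_equations x v p r ->
  is_derive (fun s => dot (v s) p) t
    (1 - dot (r t) (plus (r t) p) - dot (v t) p ^ 2).
Proof.
  intros Dv (_ & H); destruct (H t) as (Hx & Hv & _ & _ & _ & HT).
  rewrite Hx in HT; apply vnorm_eq1 in HT.
  evar_last.
  - now apply is_derive_dot_const.
  - rewrite Hv, dot_minus_l, dot_scal_l.
    rewrite ?dot_plus_l, ?dot_plus_r, (dot_comm (r t) p) in *; simpl; lra.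
Qed.

(** Since |r|^2 solves the linear equation f' = 2 c f, multiplying it by the
    integrating factor exp (- 2 int c) gives a constant; so r vanishes
    identically as soon as it vanishes once, and then x' = p. *)
Lemma linear_track_of_zero (x v r : R -> vec3) (p : vec3) (t0 : R) :
  smooth x -> (forall t, vdifferentiable v t) ->
  geodesic_equations x v p r ->
  dot (r t0) (r t0) = 0 -> linear_track x.
Proof.
  intros Sx Dv G H0.
  set (c := fun s => dot (v s) p).
  assert (Cc : forall t, continuous c t).
  { intros t; apply (ex_derive_continuous c).
    eexists; apply (is_derive_v_dot_p x v r p t (Dv t) G). }
  assert (DC : forall t, is_derive (fun s => RInt c t0 s) t (c t)).
  { intros t; apply is_derive_RInt with t0; auto.
    apply filter_forall; intros s.
    apply (RInt_correct (V := R_CompleteNormedModule)).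
    apply ex_RInt_continuous; auto. }
  assert (DF : forall t, is_derive
    (fun s => dot (r s) (r s) * exp (- 2 * RInt c t0 s)) t 0).
  { intros t; evar_last.
    - apply (is_derive_mult (fun s => dot (r s) (r s))
               (fun s => exp (- 2 * RInt c t0 s))).
      + apply (is_derive_r_sqr x v r p t G).
      + apply (is_derive_comp exp (fun s => - 2 * RInt c t0 s)).
        * apply is_derive_exp.
        * apply is_derive_scal, DC.
      + intros; apply Rmult_comm.
    - unfold plus, mult, scal; simpl; unfold mult, c; simpl; ring. }
  assert (Hr : forall t, r t = zero).
  { intros t; apply dot_self_eq0.
    pose proof (is_derive_zero_const _ DF t t0) as E; simpl in E.
    rewrite H0, Rmult_0_l in E.
    destruct (Rmult_integral _ _ E) as [E' | E']; auto.
    pose proof (exp_pos (- 2 * RInt c t0 t)); lra. }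
  assert (Hx : forall t, vderive x t = p).
  { intros t; destruct G as (_ & H); destruct (H t) as (-> & _).
    now rewrite Hr, plus_zero_r. }
  assert (L : forall (f : R -> R) (k : R), (forall t, ex_derive f t) ->
             (forall t, Derive f t = k) -> forall t, f t = f 0 + t * k).
  { intros f k Df Hk t.
    assert (D : forall u, is_derive (fun s => f s - s * k) u 0).
    { intros u; auto_derive; auto. change (1 * Derive f u + - (1 * k) = 0).
      rewrite Hk; ring. }
    pose proof (is_derive_zero_const _ D t 0); simpl in *; lra. }
  exists (x 0), p; intros t; exists t.
  apply vec3_ext.
  - apply (L (fun s => c1 (x s)) (c1 p)).
    + intros u; apply (smooth_vdifferentiable x u Sx).
    + intros u; now rewrite <- (Hx u).
  - apply (L (fun s => c2 (x s)) (c2 p)).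
    + intros u; apply (smooth_vdifferentiable x u Sx).
    + intros u; now rewrite <- (Hx u).
  - apply (L (fun s => c3 (x s)) (c3 p)).
    + intros u; apply (smooth_vdifferentiable x u Sx).
    + intros u; now rewrite <- (Hx u).
Qed.

(** Both sides of c |r|^2 = r . r' = kappa (r . N) are differentiable.  If
    kappa and kappa' vanish, so does the derivative of the right-hand side,
    while that of the left-hand side is |r|^2 when c = w = 0, because then
    c' = 1. *)
Lemma flat_inflection (x v r N : R -> vec3) (kappa : R -> R) (p : vec3)
    (t0 : R) :
  vdifferentiable v t0 -> vdifferentiable N t0 ->
  geodesic_equations x v p r ->
  (forall t, vderive (vderive x) t = scal (kappa t) (N t)) ->
  kappa t0 = 0 -> is_derive kappa t0 0 ->
  dot (v t0) p = 0 -> dot (r t0) (plus (r t0) p) = 0 ->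
  dot (r t0) (r t0) = 0.
Proof.
  intros Dv DN G Hk Hk0 Dk Hc Hw.
  assert (E : forall t,
    kappa t * dot (r t) (N t) = dot (v t) p * dot (r t) (r t)).
  { intros t.
    rewrite <- dot_scal_r, <- Hk, (geodesic_acceleration x v r p t G).
    destruct G as (_ & H); destruct (H t) as (_ & _ & _ & _ & Hrv & _).
    rewrite dot_minus_r, !dot_scal_r, Hrv; ring. }
  assert (Dr : vdifferentiable r t0).
  { apply smooth_vdifferentiable, G. }
  pose proof (is_derive_mult _ _ _ _ _ Dk (is_derive_dot r N t0 Dr DN)
                Rmult_comm) as D1.
  pose proof (is_derive_mult _ _ _ _ _ (is_derive_v_dot_p x v r p t0 Dv G)
                (is_derive_r_sqr x v r p t0 G) Rmult_comm) as D2.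
  apply (is_derive_ext _ _ _ _ E) in D1.
  apply is_derive_unique in D1; apply is_derive_unique in D2.
  unfold mult in D1, D2; simpl in D1, D2.
  rewrite D1, Hk0, Hc, Hw in D2.
  unfold plus in D2; simpl in D2; lra.
Qed.

(** Here w = 1 + a, so the energy identity gives c r = 0; and r does not
    vanish, as w = r . T. *)
Lemma frame_at_maximal_curvature (x v r : R -> vec3) (p : vec3) (a b t : R) :
  geodesic_equations x v p r ->
  (forall s, dot p (cross (v s) (vderive x s)) = b) ->
  0 <= a -> a ^ 2 = vnorm p ^ 2 - b ^ 2 ->
  dot (r t) (plus (r t) p) = 1 + a ->
  dot (v t) (vderive x t) = 0 /\
  v t = opp (scal (/ (1 + a)) (vderive (vderive x) t)).
Proof.
  intros G Hb Ha0 Ha Hw.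
  pose proof (geodesic_energy x v r p a b t G Hb Ha) as E.
  rewrite Hw in E.
  assert (Hr : dot (r t) (r t) <> 0).
  { intros Z; apply dot_self_eq0 in Z.
    rewrite Z, dot_zero_l in Hw; lra. }
  assert (Hc : dot (v t) p = 0).
  { assert (Z : dot (v t) p ^ 2 * dot (r t) (r t) = 0) by lra.
    destruct (Rmult_integral _ _ Z); [nra | contradiction]. }
  rewrite (geodesic_acceleration x v r p t G), Hw, Hc.
  split.
  - destruct G as (_ & H); destruct (H t) as (-> & _ & _ & _ & Hrv & _).
    rewrite dot_plus_r, Hc, (dot_comm (v t)), Hrv; ring.
  - assert (L : forall k s, k = - (/ (1 + a) * (0 * s + - ((1 + a) * k)))).
    { intros k s; field; lra. }
    apply vec3_ext; apply L.
Qed.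

(** * The maximum of the curvature *)

(** Criticality of kappa at t0 leaves w = 1 + a or w = 1 - a.  Zeros of kappa
    are treated separately because the sign of kappa is normalized only in
    their absence. *)
Lemma curvature_at_maximum (x v r N : R -> vec3) (kappa tau : R -> R)
    (p : vec3) (a b t0 : R) :
  smooth x -> (forall t, vdifferentiable v t) -> ~ linear_track x ->
  geodesic_equations x v p r ->
  (forall s, dot p (cross (v s) (vderive x s)) = b) ->
  0 <= a -> a ^ 2 = vnorm p ^ 2 - b ^ 2 ->
  frenet_serret x N kappa tau ->
  (forall t, kappa t <= kappa t0) ->
  kappa t0 = 1 + a.
Proof.
  intros Sx Dv NL G Hb Ha0 Ha (AN & Ak & _ & F & Pos) Max.
  assert (K : forall t,
    kappa t ^ 2 = a ^ 2 - 1 + 2 * dot (r t) (plus (r t) p)).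
  { intros t; destruct (F t) as (HN & _ & Hk & _).
    now apply (curvature_sqr x v r N kappa p a b t). }
  pose proof (fun t => geodesic_energy x v r p a b t G Hb Ha) as E.
  pose proof (fun t => geodesic_r_sqr x v r p t G) as Q.
  pose proof (is_derive_at_maximum _ _ (analytic_ex_derive _ t0 Ak) Max) as Dk.
  assert (KR : forall t, kappa t ^ 2 = dot (r t) (r t) + (a ^ 2 - dot p p)).
  { intros t; rewrite K, Q; ring. }
  assert (Dk2 : forall t, is_derive (fun s => kappa s ^ 2) t
                  (2 * (dot (v t) p * dot (r t) (r t)))).
  { intros t.
    apply is_derive_ext with (fun s => dot (r s) (r s) + (a ^ 2 - dot p p)).
    { intros s; now rewrite KR. }
    evar_last.
    - apply (is_derive_plus (fun s => dot (r s) (r s))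
               (fun _ => a ^ 2 - dot p p)).
      + apply (is_derive_r_sqr x v r p t G).
      + apply (is_derive_const (a ^ 2 - dot p p)).
    - apply plus_zero_r. }
  assert (Low : forall t, (1 - a) ^ 2 <= kappa t ^ 2).
  { intros t; pose proof (dot_self_ge0 (r t)); specialize (K t).
    specialize (E t). pose proof (pow2_ge_0 (dot (v t) p)).
    assert ((1 - dot (r t) (plus (r t) p)) ^ 2 <= a ^ 2) by nra.
    assert (1 - dot (r t) (plus (r t) p) <= a) by nra.
    nra. }
  assert (C0 : dot (v t0) p * dot (r t0) (r t0) = 0).
  { pose proof (is_derive_pow kappa 2 t0 0 Dk) as D.
    pose proof (is_derive_unique _ _ _ (Dk2 t0)) as D2.
    apply is_derive_unique in D.
    pose proof (eq_trans (eq_sym D2) D) as D3; simpl in D3; lra. }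
  assert (W : dot (r t0) (plus (r t0) p) = 1 + a \/
              dot (r t0) (plus (r t0) p) = 1 - a).
  { specialize (E t0).
    assert (Z : dot (v t0) p ^ 2 * dot (r t0) (r t0) = 0).
    { replace (dot (v t0) p ^ 2 * dot (r t0) (r t0))
        with (dot (v t0) p * (dot (v t0) p * dot (r t0) (r t0))) by ring.
      rewrite C0; ring. }
    assert (Z2 : (1 + a - dot (r t0) (plus (r t0) p)) *
                 (1 - a - dot (r t0) (plus (r t0) p)) = 0) by nra.
    destruct (Rmult_integral _ _ Z2); [left | right]; lra. }
  destruct (Classical_Prop.classic (forall t, kappa t <> 0)) as [NZ | Z].
  - specialize (Pos NZ).
    destruct W as [W | W].
    { pose proof (K t0) as K0; rewrite W in K0; specialize (Pos t0); nra. }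
    assert (K0 : kappa t0 ^ 2 = (1 - a) ^ 2) by (rewrite K, W; ring).
    (* The maximum of kappa > 0 is its smallest possible value. *)
    assert (Kc : forall t, kappa t ^ 2 = (1 - a) ^ 2).
    { intros t; specialize (Low t); specialize (Max t); specialize (Pos t); nra. }
    assert (C : forall t, dot (v t) p = 0).
    { intros t.
      assert (D : is_derive (fun s => kappa s ^ 2) t 0).
      { apply is_derive_ext with (fun _ => (1 - a) ^ 2).
        - intros s; now rewrite Kc.
        - apply (is_derive_const ((1 - a) ^ 2)). }
      pose proof (is_derive_unique _ _ _ (Dk2 t)) as D2.
      apply is_derive_unique in D.
      assert (Z : dot (v t) p * dot (r t) (r t) = 0)
        by (pose proof (eq_trans (eq_sym D2) D); lra).
      destruct (Rmult_integral _ _ Z) as [| Z']; auto.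
      (* If r vanished, w = 0 would give a = 1 and then kappa = 0. *)
      apply dot_self_eq0 in Z'.
      specialize (K t); specialize (E t); specialize (NZ t).
      rewrite Z', !dot_zero_l in *.
      exfalso; nra. }
    assert (W1 : 1 - dot (r t0) (plus (r t0) p) = 0).
    { pose proof (is_derive_v_dot_p x v r p t0 (Dv t0) G) as D.
      apply (is_derive_ext _ (fun _ => 0)) in D; [| exact C].
      apply is_derive_unique in D; rewrite Derive_const, C in D; lra. }
    assert (a = 0) by lra; subst a.
    specialize (Pos t0); nra.
  - apply Classical_Pred_Type.not_all_not_ex in Z; destruct Z as (s & Hs).
    assert (A1 : a = 1) by (specialize (Low s); rewrite Hs in Low; nra).
    subst a.
    assert (K0 : 0 <= kappa t0) by (rewrite <- Hs; apply Max).
    destruct W as [W | W].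
    { specialize (K t0); rewrite W in K; nra. }
    (* With a = 1, the value w = 0 means kappa(t0) = 0. *)
    exfalso; apply NL.
    apply (linear_track_of_zero x v r p t0 Sx Dv G).
    destruct (Rmult_integral _ _ C0) as [C | R0]; auto.
    apply (flat_inflection x v r N kappa p t0); auto.
    + now apply vanalytic_vdifferentiable.
    + intros t; apply F.
    + specialize (K t0); rewrite W in K; nra.
    + lra.
Qed.

Theorem proposition3p7 :
  forall (x y : R -> vec3) (a : R) (N : R -> vec3) (kappa tau : R -> R)
         (t0 : R),
    bicycling_geodesic x y ->
    unit_speed x ->
    ~ linear_track x ->
    geodesic_parameter x (frame_direction x y) a ->
    frenet_serret x N kappa tau ->
    (forall t : R, kappa t <= kappa t0) ->
    kappa t0 = 1 + a /\
    dot (frame_direction x y t0) (vderive x t0) = 0 /\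
    frame_direction x y t0 = opp (scal (/ (1 + a)) (vderive (vderive x) t0)).
Proof.
  intros x y a N kappa tau t0 ((Sx & Sy & _) & _) _ NL
    (p & r & b & G & Hb & Ha0 & Ha) FS Max.
  assert (Dv : forall t, vdifferentiable (frame_direction x y) t).
  { intros t; apply vdifferentiable_minus; now apply smooth_vdifferentiable. }
  pose proof (curvature_at_maximum x (frame_direction x y) r N kappa tau p a b
                t0 Sx Dv NL G Hb Ha0 Ha FS Max) as K.
  split; [exact K |].
  apply (frame_at_maximal_curvature x (frame_direction x y) r p a b t0); auto.
  destruct FS as (_ & _ & _ & F & _); destruct (F t0) as (HN & _ & Hk & _).
  pose proof (curvature_sqr x _ r N kappa p a b t0 G Hb Ha HN Hk) as E.
  rewrite K in E; lra.
Qed.
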